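(* (i) Let $F_c$ be an integrable function on $\mathbb R_+=[0,\infty)$, i.e. $\int_0^\infty |F_c(x)|\,dx<\infty$, and let $f$ be the function on $\mathbb R_+$ with cosine Fourier transform $F_c$, i.e. $f(t)=\frac{2}{\pi}\int_0^\infty F_c(x)\cos tx\,dx$. Let $F_s(x)=\int_0^\infty f(t)\sin xt\,dt$ be the sine Fourier transform of $f$, understood in the $(C,1)$ sense. Then $F_s$ is integrable on $\mathbb R_+$ if and only if the Hilbert transform $\mathcal H F_c$ of (the even extension to $\mathbb R$ of) $F_c$ is integrable on $\mathbb R$. (ii) Similarly, let $F_s$ be an integrable function on $\mathbb R_+$, i.e. $\int_0^\infty |F_s(x)|\,dx<\infty$, and let $f$ be the function on $\mathbb R_+$ with sine Fourier transform $F_s$, i.e. $f(t)=\frac{2}{\pi}\int_0^\infty F_s(x)\sin tx\,dx$. Let $F_c(x)=\int_0^\infty f(t)\cos xt\,dt$ be the cosine Fourier transform of $f$, understood in the $(C,1)$ sense. Then $F_c$ is integrable on $\mathbb R_+$ if and only if the Hilbert transform $\mathcal H F_s$ of (the odd extension to $\mathbb R$ of) $F_s$ is integrable on $\mathbb R$.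
   Context: Functions are complex-valued. For an integrable function $g$ on $\mathbb R$ the Hilbert transform is $$\mathcal H g(x)=\frac1\pi\int_{\mathbb R}\frac{g(t)}{x-t}\,dt,$$ understood in the principal value sense, as $\lim_{\delta\to0+}\frac1\pi\int_{|t-x|>\delta}\frac{g(t)}{x-t}\,dt$ (for almost every $x$). A cosine Fourier transform $F_c$ is regarded as an even function on $\mathbb R$ and a sine Fourier transform $F_s$ as an odd function on $\mathbb R$; the Hilbert transforms are taken of these extensions. The integrals over $[0,\infty)$ defining the re-expanded transforms are understood in the $(C,1)$ (Cesàro) sense, for almost every $x$: $$F_s(x)=\lim_{N\to\infty}\int_0^N\Bigl(1-\frac tN\Bigr)f(t)\sin xt\,dt \quad\text{in (i)},\qquad F_c(x)=\lim_{N\to\infty}\int_0^N\Bigl(1-\frac tN\Bigr)f(t)\cos xt\,dt\quad\text{in (ii)}.$$ ''Integrable'' means belonging to $L^1$ of the indicated set. *)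

(* Defs.v *)
From mathcomp Require Import all_boot all_order all_algebra.
From mathcomp Require Import complex.
From mathcomp Require Import all_classical all_reals all_analysis.
Set Implicit Arguments.
Unset Strict Implicit.
Unset Printing Implicit Defensive.
Import Order.TTheory GRing.Theory Num.Theory.
Import numFieldTopology.Exports numFieldNormedType.Exports.
Local Open Scope classical_set_scope.
Local Open Scope ring_scope.
Local Open Scope complex_scope.

Section Defs.
Variable R : realType.
Implicit Types (D : set R) (F f g : R -> R[i]) (x t : R).

Local Notation mu := (@lebesgue_measure R).

(* [lebesgue_measure] lives on the Borel sigma-algebra; allowing modification
   on a null set gives the Lebesgue measurable integrable functions. *)
Definition L1 D f : Prop :=
  exists g : R -> R[i],
    [/\ measurable_fun D (fun x => complex.Re (g x)),
        measurable_fun D (fun x => complex.Im (g x)),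
        (\int[mu]_(x in D) (ComplexField.Normc.normc (g x))%:E < +oo)%E
      & ae_eq mu D f g].

Definition Cintegral D f : R[i] :=
  (\int[mu]_(t in D) complex.Re (f t)) +i* (\int[mu]_(t in D) complex.Im (f t)).

Definition even_ext F : R -> R[i] := fun x => F `|x|.

Definition odd_ext F : R -> R[i] := fun x => (Num.sg x)%:C * F `|x|.

Definition inv_cosine F : R -> R[i] := fun t =>
  (2 / pi)%:C * Cintegral `[0, +oo[ (fun x => F x * (cos (t * x))%:C).

Definition inv_sine F : R -> R[i] := fun t =>
  (2 / pi)%:C * Cintegral `[0, +oo[ (fun x => F x * (sin (t * x))%:C).

(* The limits below are taken in [R[i]^o], i.e. for the metric of the complex
   modulus; [lim] returns an unspecified value where there is no limit, which
   for the functions of interest happens on a null set only. *)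

Definition cesaro_integral f : R[i]^o :=
  lim ((fun N : R =>
    Cintegral `[0, N] (fun t => (1 - t / N)%:C * f t) : R[i]^o) @ +oo).

Definition sine_transform f : R -> R[i] := fun x =>
  cesaro_integral (fun t => f t * (sin (x * t))%:C).

Definition cosine_transform f : R -> R[i] := fun x =>
  cesaro_integral (fun t => f t * (cos (x * t))%:C).

Definition hilbert g : R -> R[i] := fun x =>
  lim ((fun delta : R =>
    (pi^-1)%:C * Cintegral [set t | delta < `|t - x|]
                   (fun t => g t / (x - t)%:C) : R[i]^o) @ 0^'+).

End Defs.

(* Main.v *)
Require Import Defs.
From mathcomp Require Import all_boot all_order all_algebra.
From mathcomp Require Import complex.
From mathcomp Require Import all_classical all_reals all_analysis.
From mathcomp Require Import measurable_realfun.
From mathcomp Require Import ring lra.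
Set Implicit Arguments.
Unset Strict Implicit.
Unset Printing Implicit Defensive.
Import Order.TTheory GRing.Theory Num.Theory.
Import numFieldTopology.Exports numFieldNormedType.Exports.
Local Open Scope classical_set_scope.
Local Open Scope ring_scope.

(* For [F] the even (or odd) extension, Fubini turns the Cesaro mean of order
   [N] at [x] into [+/- pi^-1 * \int F u * K_N (x - u) du], where
   [K_N s = \int_0^N (1 - t / N) * sin (s * t) dt = 1 / s - sin (N s) / (N s^2)]
   is the conjugate Fejer kernel.  The difference [D_N] between [K_N] and the
   kernel [1 / s] cut off at [|s| > 1 / N] is odd, bounded by [N], and bounded by
   [1 / (N s^2)] away from [0], so [\int F u * D_N (x - u) du] tends to [0] at
   every Lebesgue point [x] of [F].  Hence the Cesaro means and the truncated
   Hilbert transforms have the same limits at almost every [x]: the two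
   functions agree almost everywhere up to the sign, without any appeal to the
   existence of the Hilbert transform.  Integrability on the half-line and on
   the line then match because the re-expanded transforms are odd or even. *)

(** * Integrals *)

Lemma integrable_mul_bounded d (T : measurableType d) (R : realType)
    (nu : {measure set T -> \bar R}) (D : set T) (f h : T -> R) (M : R) :
  measurable D -> nu.-integrable D (EFin \o f) -> measurable_fun D h ->
  (forall x, D x -> `|h x| <= M) ->
  nu.-integrable D (EFin \o (fun x => f x * h x)).
Proof.
move=> mD fi mh hM.
have -> : EFin \o (fun x => f x * h x) = ((EFin \o f) \* (EFin \o h))%E by [].
apply: integrableMl => //; exists M; split => [|r Mr x Dx]; first exact: num_real.
by apply: le_trans (ltW Mr); exact: hM.
Qed.

(** Negation swaps the positive and negative parts. This flips the sign of a finite difference, and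
    [fine] sends an infinite one to [0] on both sides, so arbitrary functions are covered. *)
Lemma RintegralN_any d (T : measurableType d) (R : realType)
    (mu : {measure set T -> \bar R}) (D : set T) (f : T -> R) :
  \int[mu]_(x in D) (- f x) = - \int[mu]_(x in D) f x.
Proof.
rewrite /Rintegral integralE [in RHS]integralE.
have -> : (fun x => (- f x)%:E) = (\- (EFin \o f))%E by [].
rewrite funeposN funenegN.
have p0 : (0 <= \int[mu]_(x in D) (EFin \o f)^\+%E x)%E.
  by apply: integral_ge0 => x _; exact: funepos_ge0.
have n0 : (0 <= \int[mu]_(x in D) (EFin \o f)^\-%E x)%E.
  by apply: integral_ge0 => x _; exact: funeneg_ge0.
move: p0 n0; case: (integral _ _ _) => [p| |]// _;
  case: (integral _ _ _) => [n| |]// _ /=;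
  by rewrite ?oppr0// opprB.
Qed.

Lemma integrableZl_EFin d (T : measurableType d) (R : realType)
    (mu : {measure set T -> \bar R}) (D : set T) (k : R) (f : T -> R) :
  measurable D -> mu.-integrable D (EFin \o f) ->
  mu.-integrable D (EFin \o (fun x => k * f x)).
Proof.
by move=> mD fi; apply: eq_integrable (integrableZl mD k fi).
Qed.

Lemma integrable_patch d (T : measurableType d) (R : realType)
    (mu : {measure set T -> \bar R}) (D : set T) (f : T -> R) :
  measurable D -> mu.-integrable D (EFin \o f) ->
  mu.-integrable setT (EFin \o (f \_ D)).
Proof.
by move=> mD fi; rewrite -restrict_EFin; exact: (iffLR (integrable_mkcond _ mD)).
Qed.

(** * Integrals and null sets, for arbitrary functions *)

Section ae_eq_integral_nonmeasurable.
Local Open Scope ereal_scope.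
Context d (T : measurableType d) (R : realType) (mu : {measure set T -> \bar R}).
Import HBNNSimple.

Let le_integral_ae (f g : T -> \bar R) :
  (forall x, 0 <= f x) -> (forall x, 0 <= g x) -> ae_eq mu setT f g ->
  \int[mu]_x f x <= \int[mu]_x g x.
Proof.
move=> f0 g0 [N [mN N0 fgN]].
rewrite (ge0_integralTE _ f0) (ge0_integralTE _ g0).
apply: ge_ereal_sup => _ [h hf <-].
pose h' := proj_nnsfun h (measurableC mN).
have -> : sintegral mu h = sintegral mu h'.
  rewrite -!integralT_nnsfun; apply: ge0_ae_eq_integral => //;
    do ?[exact/measurable_EFinP|by move=> x _; rewrite lee_fin; exact: fun_ge0].
  exists N; split => // x /= hx; apply: contrapT => Nx; apply: hx => _.
  by rewrite mindicE mem_set ?mulr1.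
apply: ereal_sup_ubound; exists h' => // x /=.
rewrite mindicE; have [xN|xN] := boolP (x \in ~` N).
  rewrite mulr1; apply: (le_trans (hf x)).
  have -> // : f x = g x.
  by apply: contrapT => fgx; move: xN; rewrite inE; apply; apply: fgN => /= /(_ I).
by rewrite mulr0.
Qed.

(* Unlike in [ae_eq_integral], [f] and [g] need not be measurable: the integral of
   an arbitrary nonnegative function is the supremum over the simple functions
   below it, and these can be set to [0] on the exceptional null set. *)
Lemma ae_eq_integral_any (D : set T) (f g : T -> \bar R) :
  ae_eq mu D f g -> \int[mu]_(x in D) f x = \int[mu]_(x in D) g x.
Proof.
suff ge0 (f' g' : T -> \bar R) : (forall x, 0 <= f' x) -> (forall x, 0 <= g' x) ->
    ae_eq mu D f' g' -> \int[mu]_(x in D) f' x = \int[mu]_(x in D) g' x.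
  move=> /ae_eq_funeposneg[fgp fgn].
  by rewrite integralE [RHS]integralE; congr (_ - _); apply: ge0.
move=> f0 g0 fg.
have pos h : (forall x, 0 <= h x) -> forall x, 0 <= (h \_ D) x.
  by move=> h0 x; rewrite patchE; case: ifP.
rewrite integral_mkcond [RHS]integral_mkcond; apply/eqP; rewrite eq_le.
by apply/andP; split; apply: le_integral_ae; do ?[exact: pos];
  apply: filterS fg => x fgx _; rewrite !patchE; case: ifP => // /set_mem /fgx.
Qed.

Lemma ae_eq_Rintegral (D : set T) (f g : T -> R) :
  ae_eq mu D f g -> (\int[mu]_(x in D) f x = \int[mu]_(x in D) g x)%R.
Proof.
move=> fg; rewrite /Rintegral; congr fine; apply: ae_eq_integral_any.
by apply: filterS fg => x /= h /h ->.
Qed.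

End ae_eq_integral_nonmeasurable.

(** * Invariance under the reflections [u |-> c - u] *)

Section reflection.
Context {R : realType}.
Local Notation mu := (@lebesgue_measure R).

Lemma measurable_reflect (c : R) :
  measurable_fun setT ((fun u => c - u) : measurableTypeR R -> measurableTypeR R).
Proof. by apply: measurable_funB. Qed.

(** Lebesgue measure is determined by its values on the intervals []a, b]], and their preimages [[c
    - b, c - a[] have the same length. *)
Lemma lebesgue_measure_reflect (c : R) (A : set R) : measurable A ->
  pushforward mu ((fun u => c - u) : _ -> measurableTypeR R) A = mu A.
Proof.
move=> mA; apply/esym/lebesgue_measure_unique => //=.
  exact: measurable_reflect.
move=> _ _ [[a b] _ <-].
rewrite /pushforward (_ : _ @^-1` _ = `[c - b, c - a[%classic); last first.
  apply/seteqP; split => u /=; rewrite !in_itv/=; move=> /andP[h1 h2];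
    apply/andP; split; lra.
rewrite !lebesgue_measure_itv/= !lte_fin.
have -> : (c - b < c - a) = (a < b) by apply/idP/idP => ?; lra.
by case: ifP => // _; rewrite -!EFinD; congr EFin; ring.
Qed.

Lemma ge0_integral_reflect (c : R) (D : set R) (f : R -> \bar R) :
  measurable D -> measurable_fun D f -> (forall x, 0 <= f x)%E ->
  (\int[mu]_(u in [set u | D (c - u)%R]) f (c - u)%R = \int[mu]_(u in D) f u)%E.
Proof.
move=> mD mf f0.
pose refl := (fun u => c - u)%R : R -> measurableTypeR R.
transitivity (\int[pushforward mu refl]_(u in D) f u)%E.
  by rewrite ge0_integral_pushforward//; exact: measurable_reflect.
apply: eq_measure_integral => /=; first exact: measurable_reflect.
by move=> _ B mB _; exact: lebesgue_measure_reflect.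
Qed.

Lemma integral_reflect (c : R) (D : set R) (f : R -> \bar R) :
  measurable D -> measurable_fun D f ->
  (\int[mu]_(u in [set u | D (c - u)%R]) f (c - u)%R = \int[mu]_(u in D) f u)%E.
Proof.
move=> mD mf; rewrite integralE [RHS]integralE.
congr (_ - _)%E.
  rewrite -(ge0_integral_reflect c mD (measurable_funepos mf)).
    by apply: eq_integral => x _; rewrite !funeposE.
  by move=> x; exact: funepos_ge0.
rewrite -(ge0_integral_reflect c mD (measurable_funeneg mf)).
  by apply: eq_integral => x _; rewrite !funenegE.
by move=> x; exact: funeneg_ge0.
Qed.

Lemma Rintegral_reflect (c : R) (D : set R) (f : R -> R) :
  measurable D -> measurable_fun D f ->
  \int[mu]_(u in [set u | D (c - u)]) f (c - u) = \int[mu]_(u in D) f u.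
Proof.
move=> mD mf; rewrite /Rintegral; congr fine.
by rewrite -(@integral_reflect c D (EFin \o f))//; exact/measurable_EFinP.
Qed.

Lemma integrable_reflect (c : R) (f : R -> R) :
  mu.-integrable setT (EFin \o f) ->
  mu.-integrable setT (EFin \o (fun u => f (c - u))).
Proof.
move=> /integrableP[mf fi]; apply/integrableP; split.
  apply: (measurableT_comp mf); exact: measurable_reflect.
apply: le_lt_trans fi; rewrite le_eqVlt; apply/orP; left; apply/eqP.
have mf' : measurable_fun setT (abse \o (EFin \o f)) by exact: measurableT_comp.
exact: (ge0_integral_reflect c measurableT mf' (fun=> abse_ge0 _)).
Qed.

Lemma negligible_opp (A : set R) :
  mu.-negligible A -> mu.-negligible [set x | A (- x)].
Proof.
move=> [B [mB B0 AB]]; exists [set x | B (- x)]; split.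
- rewrite -[X in measurable X]setTI.
  exact: (measurableT_comp (@oppr_measurable R setT)).
- rewrite -B0; have := lebesgue_measureN mB; exact.
- by move=> x /= /AB.
Qed.

End reflection.

(** The inverse is continuous on the open set of nonzero reals, and any function is measurable on
    the singleton left over. *)
Lemma measurable_invr (R : realType) : measurable_fun setT (@GRing.inv R).
Proof.
rewrite (_ : setT = [set x : R | x != 0] `|` [set 0]); last first.
  by apply/seteqP; split => x //= _; case: (eqVneq x 0); [right|left].
have o : open [set x : R | x != 0].
  by have := @closed_eq R 0; rewrite -openC; congr open; apply/seteqP; split => x /= /eqP.
apply/measurable_funU => //; first exact: open_measurable.
split; last exact: measurable_fun_set1.
apply: open_continuous_measurable_fun => // x /set_mem /= x0.
exact: inv_continuous.
Qed.

(** * The conjugate Fejer kernel *)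

Section kernel.
Context {R : realType}.
Local Notation mu := (@lebesgue_measure R).
Implicit Types (N s t r : R).

Lemma le_normr_sin s : `|sin s| <= 1.
Proof. by rewrite ler_norml sin_geN1 sin_le1. Qed.

Lemma le_normr_cos s : `|cos s| <= 1.
Proof. by rewrite ler_norml cos_geN1 cos_le1. Qed.

Lemma measurable_sin : measurable_fun setT (@sin R).
Proof. exact: (continuous_measurable_fun (@continuous_sin R)). Qed.

Lemma measurable_cos : measurable_fun setT (@cos R).
Proof. exact: (continuous_measurable_fun (@continuous_cos R)). Qed.

(* At [s = 0] both quotients are [0], the value there of
   [\int_0^N (1 - t / N) * sin (s * t) dt]. *)
Definition conj_fejer N s : R := s^-1 - sin (N * s) / (N * s ^+ 2).

Lemma conj_fejerN N s : conj_fejer N (- s) = - conj_fejer N s.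
Proof. by rewrite /conj_fejer mulrN sinN sqrrN invrN mulNr opprB opprK addrC. Qed.

Lemma measurable_conj_fejer N : measurable_fun setT (conj_fejer N).
Proof.
apply: measurable_funB; first exact: measurable_invr.
apply: measurable_funM.
  by apply: measurableT_comp; [exact: measurable_sin|exact: mulrl_measurable].
apply: (measurableT_comp (@measurable_invr R)).
by apply: measurable_funM => //; exact: exprn_measurable.
Qed.

Lemma integral_conj_fejer N s : 0 < N ->
  \int[mu]_(t in `[0, N]) ((1 - t / N) * sin (s * t)) = conj_fejer N s.
Proof.
move=> N0; have [->|s0] := eqVneq s 0.
  under eq_Rintegral do rewrite mul0r sin0 mulr0.
  by rewrite /conj_fejer invr0 !mulr0 sin0 mul0r subr0 Rintegral_cst// mul0r.
(* Primitive found by integration by parts: the cosine terms of its derivative cancel. The end [0]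
   contributes [s^-1], the end [N] the sine quotient. *)
pose F t := - ((1 - t / N) * (cos (s * t) / s)) - sin (s * t) / (N * s ^+ 2).
have dF t : is_derive t 1 F ((1 - t / N) * sin (s * t)).
  apply: is_derive_eq.
  rewrite /GRing.scale/=; field.
  by rewrite s0 gt_eqF.
rewrite /Rintegral (@continuous_FTC2 _ _ F) //.
- rewrite /= /F /conj_fejer mulr0 sin0 cos0 mulfV ?gt_eqF//.
  by rewrite (mulrC s); field; rewrite s0 gt_eqF.
- apply: continuous_subspaceT => t.
  apply: cvgM; last first.
    by apply: continuous_comp; [exact: mulrl_continuous|exact: continuous_sin].
  apply: cvgB; first exact: cvg_cst.
  exact: mulrr_continuous.
- have cF t : {for t, continuous F}.
    by apply: differentiable_continuous; apply/derivable1_diffP; exact: ex_derive.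
  split; [by move=> t _; exact: ex_derive| | ].
  + by apply: cvg_at_right_filter; exact: cF.
  + by apply: cvg_at_left_filter; exact: cF.
- by move=> t _; rewrite derive1E derive_val.
Qed.

Lemma integrable_cesaro N (g : R -> R) : 0 < N ->
  measurable_fun setT g -> (forall t, `|g t| <= 1) ->
  mu.-integrable `[0, N] (EFin \o (fun t => (1 - t / N) * g t)).
Proof.
move=> N0 mg g1; apply: (integrable_mul_bounded (M := 1)) => //; last first.
  exact: measurable_funTS.
apply: continuous_compact_integrable; first exact: segment_compact.
apply: continuous_subspaceT => t; apply: cvgB; first exact: cvg_cst.
exact: mulrr_continuous.
Qed.

(** Read off from the integral form, whose integrand is at most [1] in absolute value on an interval
    of length [N]; the closed form hides this near [s = 0]. *)
Lemma conj_fejer_le N s : 0 < N -> `|conj_fejer N s| <= N.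
Proof.
move=> N0; rewrite -integral_conj_fejer//.
have muN : (mu `[0%R, N] = N%:E)%E.
  by rewrite lebesgue_measure_itv/= lte_fin N0 oppr0 adde0.
have eN : \int[mu]_(t in `[0, N]) (cst 1 t) = N.
  by rewrite Rintegral_cst// mul1r; exact: (congr1 fine muN).
have fi : mu.-integrable `[0, N] (EFin \o (fun t => (1 - t / N) * sin (s * t))).
  apply: integrable_cesaro => // [|t]; last exact: le_normr_sin.
  by apply: measurableT_comp; [exact: measurable_sin|exact: mulrl_measurable].
apply: (le_trans (le_normr_Rintegral _ fi)) => //.
rewrite -[leRHS]eN; apply: le_Rintegral => //.
- exact: integrable_norm.
- apply: continuous_compact_integrable; first exact: segment_compact.
  by apply: continuous_subspaceT => t; exact: cvg_cst.
move=> t; rewrite /= in_itv/= => /andP[t0 tN].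
rewrite normrM mulr_ile1//; last exact: le_normr_sin.
rewrite ger0_norm; first by rewrite gerBl divr_ge0// ltW.
by rewrite subr_ge0 ler_pdivrMr// mul1r.
Qed.

(** Kernel of the truncated Hilbert transform, extended by [0] so that truncation becomes a
    convolution on the whole line. *)
Definition cut_inv r s : R := if r < `|s| then s^-1 else 0.

Lemma cut_invN r s : cut_inv r (- s) = - cut_inv r s.
Proof. by rewrite /cut_inv normrN; case: ifP => // _; rewrite ?oppr0 ?invrN. Qed.

Lemma measurable_cut_inv r : measurable_fun setT (cut_inv r).
Proof.
apply: measurable_fun_ifT; first 1 last.
- exact: measurable_invr.
- exact: measurable_cst.
- by apply: measurable_fun_ltr.
Qed.

Lemma cut_inv_le r s : 0 < r -> `|cut_inv r s| <= r^-1.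
Proof.
move=> r0; rewrite /cut_inv; case: ifPn => rs; last by rewrite normr0 invr_ge0 ltW.
by rewrite normfV lef_pV2 ?ltW// posrE // (lt_trans r0).
Qed.

(** The kernel [D_N]: the truncation radius is tied to the Cesaro order by [delta = 1 / N]. *)
Definition diff_ker N s : R := conj_fejer N s - cut_inv N^-1 s.

Lemma diff_kerN N s : diff_ker N (- s) = - diff_ker N s.
Proof. by rewrite /diff_ker conj_fejerN cut_invN; ring. Qed.

Lemma measurable_diff_ker N : measurable_fun setT (diff_ker N).
Proof.
by apply: measurable_funB; [exact: measurable_conj_fejer|exact: measurable_cut_inv].
Qed.

(** Beyond the cut the terms [1 / s] cancel and only [sin (N s) / (N s^2)] remains. *)
Lemma diff_ker_far N r s : 0 < N -> N^-1 <= r -> r <= `|s| ->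
  `|diff_ker N s| <= (N * r ^+ 2)^-1.
Proof.
move=> N0 Nr rs; have r0 : 0 < r by apply: lt_le_trans Nr; rewrite invr_gt0.
rewrite /diff_ker /cut_inv; case: ifPn => Ns.
  rewrite /conj_fejer addrAC subrr add0r normrN normrM normfV.
  rewrite -[leRHS]mul1r ler_pM ?invr_ge0 ?normr_ge0 ?le_normr_sin//.
  have s0 : 0 < `|s| by exact: lt_le_trans rs.
  rewrite normrM (gtr0_norm N0) normrX lef_pV2 ?posrE ?mulr_gt0 ?exprn_gt0//.
  by rewrite ler_pM2l// ler_pXn2r// nnegrE ltW.
(* The cut is strict, so [|s| = N^-1] is still uncut; then [r = N^-1] as well and the claimed bound
   is exactly [N]. *)
have sN : `|s| = N^-1 by apply/eqP; rewrite eq_le leNgt Ns (le_trans Nr).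
have -> : r = N^-1 by apply/eqP; rewrite eq_le Nr andbT -sN.
rewrite subr0 (le_trans (conj_fejer_le _ N0))//.
by rewrite exprVn expr2 invfM invrK mulrA mulVf ?mul1r ?gt_eqF.
Qed.

(** The two regimes give the same constant: the far bound at [r = N^-1] equals [N], and inside the
    cut only the conjugate Fejer kernel is left. *)
Lemma diff_ker_le N s : 0 < N -> `|diff_ker N s| <= N.
Proof.
move=> N0; have [Ns|sN] := leP N^-1 `|s|.
  apply: (le_trans (diff_ker_far N0 (lexx _) Ns)).
  by rewrite exprVn expr2 invfM invrK mulrA mulVf ?mul1r ?gt_eqF.
by rewrite /diff_ker /cut_inv ltNge (ltW sN)/= subr0 conj_fejer_le.
Qed.

End kernel.

(** * Vanishing of the difference kernel at Lebesgue points *)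

Section convergence.
Context {R : realType}.
Local Notation mu := (@lebesgue_measure R).
Implicit Types (G : R -> R) (x : R).

(** The ball has length [2 r], so an average oscillation below [e / 2] is a mass below [e * r]; this
    linear form is what the dyadic summation uses. *)
Lemma lebesgue_pt_oscillation G x (e : R) : lebesgue_pt G x -> 0 < e ->
  exists2 d : R, 0 < d & forall r, 0 < r < d ->
    (\int[mu]_(u in ball x r) `|G u - G x|%:E <= (e * r)%:E)%E.
Proof.
move=> Gx e0; have e20 : (0%R < (e / 2)%:E)%E by rewrite lte_fin divr_gt0.
have [d /= d0 dG] := Gx _ (open_ereal_lt' e20).
exists d => // r /andP[r0 rd].
have dr : ball 0 d r by rewrite /ball/= sub0r normrN gtr0_norm.
have /= := dG _ dr r0; rewrite /davg /iavg. rewrite (lebesgue_measure_ball _ (ltW r0)).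
have -> : ((r *+ 2)%:E^-1 = ((r *+ 2)^-1)%:E :> \bar R)%E.
  by rewrite inver gt_eqF ?pmulrn_lgt0.
rewrite lte_pdivrMl ?pmulrn_lgt0// => /ltW.
by rewrite -EFinM (_ : r *+ 2 * (e / 2) = e * r)//; field.
Qed.

Lemma kernel_mass_le (w h : R -> R) (A : set R) (c : R) : measurable A ->
  measurable_fun setT w -> measurable_fun setT h ->
  (forall u, A u -> `|h u| <= c) ->
  (\int[mu]_(u in A) (`|w u| * `|h u|)%:E <= c%:E * \int[mu]_(u in A) `|w u|%:E)%E.
Proof.
move=> mA mw mh hc; have [[u Au]|A0] := pselect (A !=set0); last first.
  have -> : A = set0 by apply/seteqP; split => // u Au; apply: A0; exists u.
  by rewrite !integral_set0 mule0.
have c0 : 0 <= c by apply: le_trans (hc _ Au).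
have mnw : measurable_fun A (fun u => `|w u|%:E).
  by apply/measurable_EFinP; apply: measurable_funTS; apply: measurableT_comp.
rewrite -ge0_integralZl//; apply: ge0_le_integral => //.
- apply/measurable_EFinP; apply: measurable_funTS.
  by apply: measurable_funM; apply: measurableT_comp.
- exact: measurable_funeM.
- by move=> v Av; rewrite -EFinM lee_fin mulrC ler_wpM2r// hc.
Qed.

(* Induction over the balls of radius [2 ^ k / N]: the shell between the [k]-th and
   the next one carries a kernel of size [N / 4 ^ k] on a ball of radius
   [2 ^ k.+1 / N], hence a mass of at most [2 e / 2 ^ k]. *)
Lemma kernel_mass_ball (w : R -> R) x (d e N : R) : 0 < N -> 0 < d -> 0 < e ->
  measurable_fun setT w ->
  (forall r, 0 < r ->
    (\int[mu]_(u in ball x d `&` ball x r) `|w u|%:E <= (e * r)%:E)%E) ->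
  (\int[mu]_(u in ball x d) (`|w u| * `|diff_ker N (x - u)%R|)%:E <= (5 * e)%:E)%E.
Proof.
move=> N0 d0 e0 mw we.
have mker : measurable_fun setT (fun u : R => diff_ker N (x - u)).
  by apply: (measurableT_comp (@measurable_diff_ker R N)); exact: measurable_reflect.
have mwk : measurable_fun setT (fun u : R => (`|w u| * `|diff_ker N (x - u)%R|)%:E).
  by apply/measurable_EFinP; apply: measurable_funM; apply: measurableT_comp.
(* Intersecting with [ball x d] lets the dyadic radii grow past [d], so the last shell needs no
   separate treatment. *)
pose B k := ball x d `&` ball x (2 ^+ k / N).
have mB k : measurable (B k) by apply: measurableI; exact: measurable_ball.
have pN k : 0 < 2 ^+ k / N :> R by rewrite divr_gt0// exprn_gt0.
(* The constant is the partial sum [1 + 2 + 1 + 1/2 + ...]: mass [e] on the first ball, then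
   [2 e / 2 ^ j] for each shell [j < k]. *)
have JB k : (\int[mu]_(u in B k) (`|w u| * `|diff_ker N (x - u)%R|)%:E <=
    ((5 - 4 / 2 ^+ k) * e)%:E)%E.
  elim: k => [|k IH].
    have -> : (5 - 4 / 2 ^+ 0) * e = N * (e * (2 ^+ 0 / N)) :> R.
      by rewrite expr0; field; rewrite gt_eqF.
    apply: (le_trans (@kernel_mass_le w _ (B 0%N) N _ _ _ _)) => //.
      by move=> u _; exact: diff_ker_le.
    by rewrite EFinM lee_pmul2l ?lte_fin//; exact: we.
  have BS : B k `<=` B k.+1.
    move=> u [ud uk]; split => //; apply: le_ball uk.
    by rewrite ler_pM2r ?invr_gt0// ler_eXn2l// ltr1n.
  have mBD : measurable (B k.+1 `\` B k) by exact: measurableD.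
  rewrite -(setDUK BS) ge0_integral_setU; first last.
  - by apply/disj_setPS => u [Bu []].
  - by move=> u _; rewrite lee_fin mulr_ge0.
  - exact: measurable_funTS.
  - exact: mBD.
  - exact: mB.
  have -> : (5 - 4 / 2 ^+ k.+1) * e = (5 - 4 / 2 ^+ k) * e + 2 / 2 ^+ k * e :> R.
    by rewrite exprS; field; rewrite expf_neq0.
  rewrite EFinD; apply: leeD => //.
  apply: (le_trans (@kernel_mass_le w _ _ (N * (2 ^+ k / N) ^+ 2)^-1 _ _ _ _)) => //.
  - move=> u [[ud uk] Bu]; apply: diff_ker_far => //.
      by rewrite ler_peMl ?invr_ge0 ?(ltW N0)// exprn_ege1// ler1n.
    by rewrite leNgt; apply/negP => xu; apply: Bu; split.
  have -> : 2 / 2 ^+ k * e = (N * (2 ^+ k / N) ^+ 2)^-1 * (e * (2 ^+ k.+1 / N)) :> R.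
    have : 2 ^+ k != 0 :> R by rewrite expf_neq0.
    by rewrite (exprS 2 k); move: (2 ^+ k) => p p0; field; rewrite (gt_eqF N0).
  rewrite [leRHS]EFinM lee_pmul2l ?lte_fin ?invr_gt0 ?mulr_gt0 ?exprn_gt0 ?invr_gt0//.
  apply: le_trans (we _ (pN k.+1)); apply: ge0_subset_integral => //.
  - exact: mB.
  - by apply/measurable_EFinP; apply: measurable_funTS; apply: measurableT_comp.
have [k dk] : exists k : nat, d <= 2 ^+ k / N.
  exists (Num.bound (d * N)); rewrite ler_pdivlMr//.
  apply: (le_trans (ltW (archi_boundP _))); first by rewrite mulr_ge0// ltW.
  by rewrite -natrX ler_nat ltnW// ltn_expl.
have -> : ball x d = B k.
  by apply/seteqP; split => [u ud|u []//]; split => //; exact: le_ball ud.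
apply: (le_trans (JB k)); rewrite lee_fin ler_wpM2r ?(ltW e0)//.
by rewrite gerBl divr_ge0// exprn_ge0.
Qed.

(** The reflection [u |-> 2 x - u] preserves the ball and changes the sign of the integrand, so the
    integral is its own opposite. *)
Lemma Rintegral_ball_odd (h : R -> R) x d : measurable_fun setT h ->
  (forall s, h (- s) = - h s) -> \int[mu]_(u in ball x d) h (x - u) = 0.
Proof.
move=> mh hN; have mhx : measurable_fun setT (fun u : R => h (x - u)).
  by apply: (measurableT_comp mh); exact: measurable_reflect.
have := @Rintegral_reflect R (2 * x) (ball x d) (fun u => h (x - u))
  (measurable_ball _ _) (measurable_funTS mhx).
have -> : [set u | ball x d (2 * x - u)] = ball x d.
  by apply/seteqP; split => u; rewrite /ball /=;
    (have -> : x - (2 * x - u) = - (x - u) by ring); rewrite normrN.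
have -> : (fun u => h (x - (2 * x - u))) = (fun u => - h (x - u)).
  by apply/funext => u; rewrite -hN; congr h; ring.
by rewrite RintegralN_any => H; lra.
Qed.

(** Split at a small ball around [x]. Inside, the dyadic estimate bounds the integral by the
    oscillation of [G], uniformly in [N]; outside, the kernel is [O(1 / N)] and [G] is
    integrable. *)
Lemma cvg_diff_ker G x : mu.-integrable setT (EFin \o G) -> lebesgue_pt G x ->
  \int[mu]_u (G u * diff_ker N (x - u)) @[N --> +oo] --> (0 : R).
Proof.
move=> Gi Gx; apply/cvgrPdist_lt => e e0.
have mG : measurable_fun setT G by apply/measurable_EFinP; exact: measurable_int Gi.
(* The near part will be at most [5 * e'], and [5 / 12 < 1 / 2]. *)
pose e' := e / 12; have e'0 : 0 < e' by rewrite divr_gt0.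
have [d0 d0gt osc] := lebesgue_pt_oscillation Gx e'0.
(* Strictly below [d0], so that the oscillation bound applies to the radius [d] itself. *)
pose d := d0 / 2; have dgt : 0 < d by rewrite divr_gt0.
have dd0 : d < d0 by rewrite /d; lra.
pose w u := G u - G x.
have mw : measurable_fun setT w by apply: measurable_funB => //; exact: measurable_cst.
have mnw D : measurable_fun D (fun u => `|w u|%:E).
  by apply: measurable_funTS; apply/measurable_EFinP; apply: measurableT_comp.
have wosc r : 0 < r ->
    (\int[mu]_(u in ball x d `&` ball x r) `|w u|%:E <= (e' * r)%:E)%E.
  (* Radii beyond [d] do not enlarge the intersection, so the bound at [d] serves for them. *)
  move=> r0; have [rd|dr] := leP r d.
    apply: le_trans (osc r _); last by rewrite r0 (le_lt_trans rd).
    apply: ge0_subset_integral => //; [|exact: measurable_ball|exact: mnw].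
    by apply: measurableI; exact: measurable_ball.
  apply: (@le_trans _ _ (e' * d)%:E); last by rewrite lee_fin ler_wpM2l// ltW.
  apply: le_trans (osc d _); last by rewrite dgt.
  apply: ge0_subset_integral => //; [|exact: measurable_ball|exact: mnw].
  by apply: measurableI; exact: measurable_ball.
pose A := \int[mu]_u `|G u|.
have A0 : 0 <= A by apply: Rintegral_ge0.
near=> N.
have N0 : 0 < N by near: N; apply: nbhs_pinfty_gt; exact: num_real.
have Nd : N^-1 <= d.
  rewrite -[leRHS]invrK lef_pV2 ?posrE ?invr_gt0//.
have NA : (N * d ^+ 2)^-1 * A < e / 2.
  rewrite mulrC ltr_pdivrMr ?mulr_gt0 ?exprn_gt0//.
  rewrite -ltr_pdivrMl ?divr_gt0// mulrC -ltr_pdivrMr ?exprn_gt0//.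
  by near: N; apply: nbhs_pinfty_gt; exact: num_real.
have mk : measurable_fun setT (fun u : R => diff_ker N (x - u)).
  by apply: (measurableT_comp (@measurable_diff_ker R N)); exact: measurable_reflect.
have mB : measurable (ball x d : set (measurableTypeR R)) by exact: measurable_ball.
have mBC : measurable (~` ball x d : set (measurableTypeR R)) by exact: measurableC.
have muB : (mu (ball x d) < +oo)%E by rewrite (lebesgue_measure_ball _ (ltW dgt)) ltry.
have Gki : mu.-integrable setT (EFin \o (fun u => G u * diff_ker N (x - u))).
  by apply: (integrable_mul_bounded (M := N)) => // u _; exact: diff_ker_le.
have kB : mu.-integrable (ball x d) (EFin \o (fun u => diff_ker N (x - u))).
  apply: measurable_bounded_integrable => //; first exact: measurable_funTS.
  exists N; split => [|r Nr u _]; first exact: num_real.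
  by apply: le_trans (ltW Nr); exact: diff_ker_le.
have GxkB : mu.-integrable (ball x d) (EFin \o (fun u => G x * diff_ker N (x - u))).
  exact: integrableZl_EFin.
have GkB : mu.-integrable (ball x d) (EFin \o (fun u => G u * diff_ker N (x - u))).
  exact: integrableS Gki.
have GkBC : mu.-integrable (~` ball x d) (EFin \o (fun u => G u * diff_ker N (x - u))).
  exact: integrableS Gki.
have wkB : mu.-integrable (ball x d) (EFin \o (fun u => w u * diff_ker N (x - u))).
  have := integrableB mB GkB GxkB; congr integrable; apply/funext => u /=.
  by rewrite -EFinB -mulrBl.
have near_part : `|\int[mu]_(u in ball x d) (G u * diff_ker N (x - u))| <= e / 2.
  (* The odd kernel integrates to [0] over the ball, so the constant [G x] may be subtracted from
     [G]. *)
  have -> : \int[mu]_(u in ball x d) (G u * diff_ker N (x - u)) =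
      \int[mu]_(u in ball x d) (w u * diff_ker N (x - u)).
    transitivity (\int[mu]_(u in ball x d)
        (w u * diff_ker N (x - u) + G x * diff_ker N (x - u))).
      by apply: eq_Rintegral => u _; rewrite -mulrDl subrK.
    rewrite RintegralD// RintegralZl// Rintegral_ball_odd ?mulr0 ?addr0//.
      exact: measurable_diff_ker.
    exact: diff_kerN.
  apply: (le_trans (le_normr_Rintegral mB wkB)).
  have -> : \int[mu]_(u in ball x d) `|w u * diff_ker N (x - u)| =
     fine (\int[mu]_(u in ball x d) (`|w u| * `|diff_ker N (x - u)%R|)%:E)%E.
    by apply: eq_Rintegral => u _; rewrite normrM.
  have J := kernel_mass_ball N0 dgt e'0 mw wosc.
  apply: (@le_trans _ _ (5 * e')); last by rewrite /e'; lra.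
  by rewrite -lee_fin fineK// ge0_fin_numE ?(le_lt_trans J) ?ltry// integral_ge0.
have far_part : `|\int[mu]_(u in ~` ball x d) (G u * diff_ker N (x - u))| <=
    (N * d ^+ 2)^-1 * A.
  apply: (le_trans (le_normr_Rintegral mBC GkBC)).
  have Gn : mu.-integrable setT (EFin \o (fun u => `|G u|)) by exact: integrable_norm.
  have GnB : mu.-integrable (~` ball x d) (EFin \o (fun u => `|G u|)).
    exact: integrableS Gn.
  apply: (@le_trans _ _ ((N * d ^+ 2)^-1 * \int[mu]_(u in ~` ball x d) `|G u|)).
    rewrite -RintegralZl//; apply: le_Rintegral => //.
    - exact: integrable_norm.
    - exact: integrableZl_EFin.
    - move=> u ud; rewrite normrM mulrC ler_wpM2r//; apply: diff_ker_far => //.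
      by rewrite leNgt; apply/negP.
  apply: ler_wpM2l; first by rewrite invr_ge0 ltW// mulr_gt0// exprn_gt0.
  rewrite /A /Rintegral fine_le//.
  - exact: integrable_fin_num.
  - exact: integrable_fin_num.
  - apply: ge0_subset_integral => //; exact: measurable_int Gn.
rewrite sub0r normrN -(setUv (ball x d)) Rintegral_setU ?setUv//; last first.
  by apply/disj_setPS => u [].
apply: (le_lt_trans (ler_normD _ _)); rewrite [ltRHS](splitr e).
by apply: ler_ltD => //; exact: le_lt_trans NA.
Unshelve. all: by end_near. Qed.

End convergence.

(** * Re-expansion of real functions *)

Section folding.
Context {R : realType}.
Local Notation mu := (@lebesgue_measure R).
Implicit Types (F h : R -> R) (x : R).

(** The extension is [F] on the closed half-line plus the mirror image of [F] on the open one; the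
    second is open so that [0] is counted once. *)
Lemma integrable_even F : mu.-integrable `[0, +oo[ (EFin \o F) ->
  mu.-integrable setT (EFin \o (fun u => F `|u|)).
Proof.
move=> Fi.
have Fo : mu.-integrable `]0, +oo[ (EFin \o F).
  apply: integrableS Fi => // u /=; rewrite !in_itv/= !andbT; exact: ltW.
have F1 : mu.-integrable setT (EFin \o (F \_ `[0, +oo[)).
  exact: integrable_patch.
have F2 : mu.-integrable setT (EFin \o (F \_ `]0, +oo[)).
  exact: integrable_patch.
apply: eq_integrable (integrableD _ F1 (integrable_reflect 0 F2)) => // u _ /=.
rewrite -EFinD sub0r !patchE !mem_setE !in_itv/= !andbT oppr_gt0; congr EFin.
by have [u0|u0] := leP 0 u; rewrite ?addr0 ?add0r ?(ger0_norm u0) ?(ltr0_norm u0).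
Qed.

(** As in the even case with a difference, but both halves are open, in accordance with
    [Num.sg 0 = 0]. *)
Lemma integrable_odd F : mu.-integrable `[0, +oo[ (EFin \o F) ->
  mu.-integrable setT (EFin \o (fun u => Num.sg u * F `|u|)).
Proof.
move=> Fi.
have Fo : mu.-integrable `]0, +oo[ (EFin \o F).
  apply: integrableS Fi => // u /=; rewrite !in_itv/= !andbT; exact: ltW.
have F2 : mu.-integrable setT (EFin \o (F \_ `]0, +oo[)).
  exact: integrable_patch.
apply: eq_integrable (integrableB _ F2 (integrable_reflect 0 F2)) => // u _ /=.
rewrite -EFinB sub0r !patchE !mem_setE !in_itv/= !andbT oppr_gt0; congr EFin.
have [u0|u0|->] := ltgtP u 0; last by rewrite sgr0 mul0r subr0.
- by rewrite (ltr0_sg u0) (ltr0_norm u0) mulN1r sub0r.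
- by rewrite (gtr0_sg u0) (gtr0_norm u0) mul1r subr0.
Qed.

Lemma Rintegral_fold h : mu.-integrable setT (EFin \o h) ->
  \int[mu]_u h u = \int[mu]_(u in `[0, +oo[) (h u + h (- u)).
Proof.
move=> hi; have hNi : mu.-integrable setT (EFin \o (fun u => h (- u))).
  by apply: eq_integrable (integrable_reflect 0 hi) => // u _ /=; rewrite sub0r.
have mh : measurable_fun setT h by apply/measurable_EFinP; exact: measurable_int hi.
have e : setT = `[0, +oo[%classic `|` `]-oo, 0[%classic :> set R.
  by apply/seteqP; split => u //= _; rewrite !in_itv/= andbT; case: leP; [left|right].
rewrite e Rintegral_setU//; last 2 first.
- by rewrite -e.
- by apply/disj_setPS => u []/=; rewrite !in_itv/= andbT ltNge => ->.
rewrite RintegralD//; [|exact: integrableS hi|exact: integrableS hNi].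
congr (_ + _).
(* Dropping the null set [{0}] turns the second half into the exact mirror image of []-oo, 0[]. *)
rewrite -Rintegral_itv_obnd_cbnd; last exact: integrableS hNi.
rewrite -(Rintegral_reflect 0 (D := `]-oo, 0[%classic))//; last exact: measurable_funTS.
rewrite (_ : [set u : R | _] = `]0, +oo[%classic); last first.
  by apply/seteqP; split => u /=; rewrite !in_itv/= sub0r oppr_lt0 andbT.
by apply: eq_Rintegral => u _; rewrite sub0r.
Qed.

End folding.

(** * Interchange of the two integrations *)

Section fubini.
Context {R : realType}.
Local Notation mu := (@lebesgue_measure R).

(** Fubini on the whole plane after extending [c] and [F] by [0]; since [|k| <= 1], the integrand is
    dominated by [|c t| * |F u|], whose integral is a product of two finite ones. *)
Lemma Rintegral_swap (A B : set (measurableTypeR R)) (c F k : R -> R) :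
  measurable A -> measurable B ->
  mu.-integrable A (EFin \o c) -> mu.-integrable B (EFin \o F) ->
  measurable_fun setT k -> (forall s, `|k s| <= 1) ->
  \int[mu]_(t in A) (c t * \int[mu]_(u in B) (F u * k (t * u))) =
  \int[mu]_(u in B) (F u * \int[mu]_(t in A) (c t * k (t * u))).
Proof.
move=> mA mB ci Fi mk k1.
pose cA := c \_ A; pose FB := F \_ B.
have cAi : mu.-integrable setT (EFin \o cA).
  exact: integrable_patch.
have FBi : mu.-integrable setT (EFin \o FB).
  exact: integrable_patch.
have mcA : measurable_fun setT cA by apply/measurable_EFinP; exact: measurable_int cAi.
have mFB : measurable_fun setT FB by apply/measurable_EFinP; exact: measurable_int FBi.
pose phi (z : measurableTypeR R * measurableTypeR R) := cA z.1 * FB z.2 * k (z.1 * z.2).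
have mphi : measurable_fun setT phi.
  apply: measurable_funM.
    by apply: measurable_funM;
      [exact: (measurableT_comp mcA)|exact: (measurableT_comp mFB)].
  by apply: (measurableT_comp mk); apply: measurable_funM.
have phii : (mu \x mu)%E.-integrable setT (EFin \o phi).
  apply/integrable12ltyP; first exact/measurable_EFinP.
  pose M := (\int[mu]_u `|FB u|%:E)%E.
  have Moo : (M < +oo)%E.
    by move: FBi => /integrableP[_]; rewrite /M; under eq_integral do rewrite abse_EFin.
  have M0 : (0 <= M)%E by apply: integral_ge0 => u _; rewrite lee_fin.
  have mn (f : R -> R) : measurable_fun setT f ->
      measurable_fun setT (fun u => `|f u|%:E).
    by move=> mf; apply/measurable_EFinP; apply: measurableT_comp.
  apply: (@le_lt_trans _ _ (\int[mu]_t (`|cA t|%:E * M))%E).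
    apply: ge0_le_integral => //.
    - by move=> t _; apply: integral_ge0 => u _; rewrite abse_ge0.
    - apply: (measurable_fun_fubini_tonelli_F (fun z => `|(phi z)%:E|%E)).
        by apply: measurableT_comp => //; exact/measurable_EFinP.
      by move=> z; rewrite abse_ge0.
    - by apply: emeasurable_funM => //; exact: mn.
    - move=> t _; rewrite -ge0_integralZl//; [|exact: mn].
      apply: ge0_le_integral => //.
      + apply: measurableT_comp => //; apply/measurable_EFinP.
        by apply: (measurableT_comp mphi); exact: pair1_measurable.
      + by apply: emeasurable_funM => //; exact: mn.
      + move=> u _; rewrite abse_EFin -EFinM lee_fin /phi/= !normrM.
        by rewrite ler_piMr// mulr_ge0.
  rewrite ge0_integralZr//; [|exact: mn].
  apply: lte_mul_pinfty => //.
  + by apply: integral_ge0 => t _; rewrite lee_fin.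
  + move: cAi => /integrableP[_ cAoo]; rewrite ge0_fin_numE//.
    by apply: integral_ge0 => t _; rewrite lee_fin.
(* Serves both orders of integration: it turns the inner integral of an extended function back into
   one over its set. *)
have inner (D : set (measurableTypeR R)) (f : R -> R) (a s : R) : measurable D ->
    mu.-integrable D (EFin \o f) ->
    (\int[mu]_u (a * (f \_ D) u * k (s * u)%R)%:E)%E =
    (a * \int[mu]_(u in D) (f u * k (s * u)))%:E.
  move=> mD fi; have fki : mu.-integrable D (EFin \o (fun u => f u * k (s * u))).
    apply: (integrable_mul_bounded (M := 1)) => //.
    by apply: measurable_funTS; apply: (measurableT_comp mk); exact: mulrl_measurable.
  rewrite -RintegralZl// Rintegral_mkcond /Rintegral fineK.
    apply: eq_integral => u _; rewrite !patchE.
    by case: ifP => _; [rewrite mulrA|rewrite [a * _](mulr0 a) mul0r].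
  apply: integrable_fin_num => //; apply: integrable_patch => //.
  exact: integrableZl_EFin.
transitivity (fine (\int[mu]_t \int[mu]_u (phi (t, u))%:E)%E).
  rewrite Rintegral_mkcond /Rintegral; congr fine; apply: eq_integral => t _.
  rewrite /phi/= inner// /cA !patchE; case: ifP => _ //; by rewrite mul0r.
rewrite (Fubini phii) Rintegral_mkcond /Rintegral; congr fine.
apply: eq_integral => u _; rewrite /phi/=.
under eq_integral do rewrite (mulrC (cA _)) (mulrC _ u).
rewrite inner//.
rewrite /FB !patchE; case: ifP => _; last by rewrite mul0r.
by congr (_ * _)%:E; apply: eq_Rintegral => t _; rewrite (mulrC u).
Qed.

End fubini.

(** * Cesaro means as convolutions with the conjugate Fejer kernel *)

Section cesaro.
Context {R : realType}.
Local Notation mu := (@lebesgue_measure R).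
Implicit Types (F : R -> R) (N x u : R).

Let msin x : measurable_fun setT (fun t : R => sin (x * t)).
Proof. by apply: measurableT_comp; [exact: measurable_sin|exact: mulrl_measurable]. Qed.

Let mcos x : measurable_fun setT (fun t : R => cos (x * t)).
Proof. by apply: measurableT_comp; [exact: measurable_cos|exact: mulrl_measurable]. Qed.

Let sin_i N s : 0 < N ->
  mu.-integrable `[0, N] (EFin \o (fun t => (1 - t / N) * sin (s * t))).
Proof. by move=> N0; apply: integrable_cesaro => // t; exact: le_normr_sin. Qed.

(** Product to sum: [sin a * cos b] is half of [sin (a + b) + sin (a - b)], and each term integrates
    to a conjugate Fejer kernel. *)
Lemma Rintegral_sin_cos N x u : 0 < N ->
  \int[mu]_(t in `[0, N]) ((1 - t / N) * sin (x * t) * cos (t * u)) =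
  2^-1 * conj_fejer N (x + u) + 2^-1 * conj_fejer N (x - u).
Proof.
move=> N0; rewrite -!integral_conj_fejer// -!RintegralZl//; try exact: sin_i.
rewrite -RintegralD//; try by apply: integrableZl_EFin => //; exact: sin_i.
apply: eq_Rintegral => t _.
have -> : (x + u) * t = x * t + t * u by ring.
have -> : (x - u) * t = x * t - t * u by ring.
by rewrite sinD sinB; field; rewrite gt_eqF.
Qed.

Lemma Rintegral_cos_sin N x u : 0 < N ->
  \int[mu]_(t in `[0, N]) ((1 - t / N) * cos (x * t) * sin (t * u)) =
  2^-1 * conj_fejer N (x + u) - 2^-1 * conj_fejer N (x - u).
Proof.
move=> N0; rewrite -!integral_conj_fejer// -!RintegralZl//; try exact: sin_i.
rewrite -RintegralB//; try by apply: integrableZl_EFin => //; exact: sin_i.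
apply: eq_Rintegral => t _.
have -> : (x + u) * t = x * t + t * u by ring.
have -> : (x - u) * t = x * t - t * u by ring.
by rewrite sinD sinB; field; rewrite gt_eqF.
Qed.

Let conv_i (G : R -> R) N x : 0 < N -> mu.-integrable setT (EFin \o G) ->
  mu.-integrable setT (EFin \o (fun u => G u * conj_fejer N (x - u))).
Proof.
move=> N0 Gi; apply: (integrable_mul_bounded (M := N)) => //.
  by apply: (measurableT_comp (@measurable_conj_fejer R N)); exact: measurable_reflect.
by move=> u _; exact: conj_fejer_le.
Qed.

(** After the interchange [F u] meets [K_N (x + u) + K_N (x - u)] on the half-line, which is the
    convolution of the even extension folded at [0]. *)
Lemma cesaro_even F N x : 0 < N -> mu.-integrable `[0, +oo[ (EFin \o F) ->
  \int[mu]_(t in `[0, N]) ((1 - t / N) *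
    (2 / pi * \int[mu]_(u in `[0, +oo[) (F u * cos (t * u)) * sin (x * t))) =
  pi^-1 * \int[mu]_u (F `|u| * conj_fejer N (x - u)).
Proof.
move=> N0 Fi.
transitivity (\int[mu]_(t in `[0, N]) ((1 - t / N) * sin (x * t) *
    \int[mu]_(u in `[0, +oo[) ((2 / pi * F u) * cos (t * u)))).
  apply: eq_Rintegral => t _.
  have -> : \int[mu]_(u in `[0, +oo[) (2 / pi * F u * cos (t * u)) =
      2 / pi * \int[mu]_(u in `[0, +oo[) (F u * cos (t * u)); last by ring.
  rewrite -RintegralZl//; first by apply: eq_Rintegral => u _; rewrite mulrA.
  apply: (integrable_mul_bounded (M := 1)) => //.
    exact: (measurable_funTS (mcos t)).
  by move=> u _; exact: le_normr_cos.
rewrite Rintegral_swap//; last 4 first.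
- by apply: integrable_cesaro => // t; exact: le_normr_sin.
- exact: integrableZl_EFin.
- exact: measurable_cos.
- exact: le_normr_cos.
have Gi := conv_i x N0 (integrable_even Fi).
rewrite -RintegralZl// Rintegral_fold; last exact: integrableZl_EFin.
apply: eq_Rintegral => u /[!inE]; rewrite /= in_itv/= andbT => u0.
rewrite Rintegral_sin_cos// normrN ger0_norm// opprK.
have pi0 : pi != 0 :> R by rewrite gt_eqF// pi_gt0.
by move: pi pi0 => p p0; field.
Qed.

(** Now [F u] meets [K_N (x + u) - K_N (x - u)], the opposite of the folded convolution of the odd
    extension; this is where the minus sign of the second part arises. *)
Lemma cesaro_odd F N x : 0 < N -> mu.-integrable `[0, +oo[ (EFin \o F) ->
  \int[mu]_(t in `[0, N]) ((1 - t / N) *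
    (2 / pi * \int[mu]_(u in `[0, +oo[) (F u * sin (t * u)) * cos (x * t))) =
  - (pi^-1 * \int[mu]_u (Num.sg u * F `|u| * conj_fejer N (x - u))).
Proof.
move=> N0 Fi.
transitivity (\int[mu]_(t in `[0, N]) ((1 - t / N) * cos (x * t) *
    \int[mu]_(u in `[0, +oo[) ((2 / pi * F u) * sin (t * u)))).
  apply: eq_Rintegral => t _.
  have -> : \int[mu]_(u in `[0, +oo[) (2 / pi * F u * sin (t * u)) =
      2 / pi * \int[mu]_(u in `[0, +oo[) (F u * sin (t * u)); last by ring.
  rewrite -RintegralZl//; first by apply: eq_Rintegral => u _; rewrite mulrA.
  apply: (integrable_mul_bounded (M := 1)) => //.
    exact: (measurable_funTS (msin t)).
  by move=> u _; exact: le_normr_sin.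
rewrite Rintegral_swap//; last 4 first.
- by apply: integrable_cesaro => // t; exact: le_normr_cos.
- exact: integrableZl_EFin.
- exact: measurable_sin.
- exact: le_normr_sin.
have Gi := conv_i x N0 (integrable_odd Fi).
rewrite -RintegralZl// Rintegral_fold; last exact: integrableZl_EFin.
rewrite -RintegralN_any.
apply: eq_Rintegral => u /[!inE]; rewrite /= in_itv/= andbT => u0.
rewrite Rintegral_cos_sin// normrN ger0_norm// opprK sgrN.
(* At [u = 0] the odd extension is [0] whatever [F 0] is; on the other side the two kernels
   cancel. *)
have [->|un0] := eqVneq u 0.
  by rewrite sgr0 !addr0 !subr0 subrr oppr0 !mul0r !mulr0 addr0 oppr0.
have -> : Num.sg u = 1 by rewrite gtr0_sg// lt_neqAle eq_sym un0.
have pi0 : pi != 0 :> R by rewrite gt_eqF// pi_gt0.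
by move: pi pi0 => p p0; field.
Qed.

End cesaro.

(** * Complex-valued functions *)

Local Open Scope complex_scope.

Section complex_functions.
Context {R : realType}.
Local Notation mu := (@lebesgue_measure R).
Local Notation Re := (@complex.Re R).
Local Notation Im := (@complex.Im R).
Implicit Types (f g : R -> R[i]) (D : set (measurableTypeR R)).

Lemma Re_mulr_real (z : R[i]) (r : R) : Re (z * r%:C) = Re z * r.
Proof. by case: z => a b /=; rewrite mulr0 subr0. Qed.

Lemma Im_mulr_real (z : R[i]) (r : R) : Im (z * r%:C) = Im z * r.
Proof. by case: z => a b /=; rewrite mulr0 add0r. Qed.

Local Notation normc := (@ComplexField.Normc.normc R).

Lemma measurable_normc D g : measurable_fun D (Re \o g) ->
  measurable_fun D (Im \o g) -> measurable_fun D (normc \o g).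
Proof.
move=> mRe mIm.
have -> : normc \o g = Num.sqrt \o (fun x => Re (g x) ^+ 2 + Im (g x) ^+ 2).
  by apply/funext => x /=; case: (g x).
apply: measurableT_comp; first exact: (continuous_measurable_fun (@sqrt_continuous R)).
by apply: measurable_funD; exact: measurable_funX.
Qed.

Lemma normr_Re_le (z : R[i]) : `|Re z| <= normc z.
Proof. by case: z => a b /=; rewrite -sqrtr_sqr ler_wsqrtr// lerDl sqr_ge0. Qed.

Lemma normr_Im_le (z : R[i]) : `|Im z| <= normc z.
Proof. by case: z => a b /=; rewrite -sqrtr_sqr ler_wsqrtr// lerDr sqr_ge0. Qed.

Lemma normc_le (z : R[i]) : normc z <= `|Re z| + `|Im z|.
Proof.
case: z => a b /=; have ab0 : 0 <= `|a| + `|b| by rewrite addr_ge0.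
rewrite -[leRHS](ger0_norm ab0) -sqrtr_sqr ler_wsqrtr// sqrrD !real_normK ?num_real//.
by rewrite -addrA lerD2l lerDr mulrn_wge0// mulr_ge0.
Qed.

Lemma normc_ge0 (z : R[i]) : 0 <= normc z.
Proof. by case: z => a b; exact: sqrtr_ge0. Qed.

(** Follows from [|Re z|, |Im z| <= |z| <= |Re z| + |Im z|], and reduces the complex statements to
    real integrable functions. *)
Lemma L1P D f : measurable D -> L1 D f <-> exists g,
  [/\ mu.-integrable D (EFin \o (Re \o g)), mu.-integrable D (EFin \o (Im \o g)) &
      ae_eq mu D f g].
Proof.
move=> mD; split => [[g [mRe mIm goo fg]]|[g [iRe iIm fg]]]; exists g.
  have ni : mu.-integrable D (EFin \o (normc \o g)).
    apply/integrableP; split; first by apply/measurable_EFinP; exact: measurable_normc.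
    by under eq_integral do rewrite abse_EFin/= ger0_norm ?normc_ge0//.
  split => //.
  - apply: le_integrable ni => //; first exact/measurable_EFinP.
    by move=> x _; rewrite !abse_EFin lee_fin/= (ger0_norm (normc_ge0 _)) normr_Re_le.
  - apply: le_integrable ni => //; first exact/measurable_EFinP.
    by move=> x _; rewrite !abse_EFin lee_fin/= (ger0_norm (normc_ge0 _)) normr_Im_le.
have mRe : measurable_fun D (Re \o g).
  by apply/measurable_EFinP; exact: measurable_int iRe.
have mIm : measurable_fun D (Im \o g).
  by apply/measurable_EFinP; exact: measurable_int iIm.
split => //.
have ni : mu.-integrable D (EFin \o (normc \o g)).
  apply: le_integrable (integrableD _ (integrable_norm iRe) (integrable_norm iIm)) => //.
    by apply/measurable_EFinP; exact: measurable_normc.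
  move=> x _ /=; rewrite lee_fin (ger0_norm (normc_ge0 _)).
  by rewrite ger0_norm ?addr_ge0// normc_le.
exact: integrable_lty.
Qed.

End complex_functions.

(** * Limits in the complex plane and the substitution [delta = 1 / N] *)

Section complex_limits.
Context {R : realType}.
Local Notation Re := (@complex.Re R).
Local Notation Im := (@complex.Im R).

Lemma cvg_inv_pinfty : (N : R)^-1 @[N --> +oo] --> 0^'+.
Proof.
move=> A [d /= d0 dA]; suff : \forall N \near +oo, A (N : R)^-1 by [].
near=> N; apply: dA => /=; last first.
  rewrite invr_gt0; near: N; apply: nbhs_pinfty_gt; exact: num_real.
have N0 : 0 < N by near: N; apply: nbhs_pinfty_gt; exact: num_real.
rewrite sub0r normrN gtr0_norm ?invr_gt0// -[ltRHS]invrK ltf_pV2 ?posrE ?invr_gt0//.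
by near: N; apply: nbhs_pinfty_gt; exact: num_real.
Unshelve. all: by end_near. Qed.

Lemma cvg_inv_right0 : (d : R)^-1 @[d --> 0^'+] --> +oo.
Proof.
apply/cvgryPgt => A; have [A0|A0] := leP A 0; near=> d.
  rewrite (le_lt_trans A0)// invr_gt0; near: d; exact: nbhs_right_gt.
have d0 : 0 < d by near: d; exact: nbhs_right_gt.
rewrite -[ltLHS]invrK ltf_pV2 ?posrE ?invr_gt0//.
by near: d; apply: nbhs_right_lt; rewrite invr_gt0.
Unshelve. all: by end_near. Qed.

Lemma cvg_complex0 (a b : R -> R) (F : set_system R) {FF : Filter F} :
  a x @[x --> F] --> (0 : R) -> b x @[x --> F] --> (0 : R) ->
  ((a x +i* b x) : R[i]^o) @[x --> F] --> (0 : R[i]^o).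
Proof.
move=> /cvgrPdist_lt a0 /cvgrPdist_lt b0; apply/cvgrPdist_lt => -[e e'].
(* The radius is a complex number here; being positive, it has imaginary part [0]. *)
rewrite ltcE/= => /andP[/eqP -> e0].
have e20 : 0 < e / 2 by rewrite divr_gt0.
near=> x; rewrite sub0r normrN normc_def ltcR.
have ax : `|a x| < e / 2 by rewrite -[ltLHS]normrN -sub0r; near: x; exact: a0.
have bx : `|b x| < e / 2 by rewrite -[ltLHS]normrN -sub0r; near: x; exact: b0.
rewrite -[ltRHS]ger0_norm ?(ltW e0)// -sqrtr_sqr ltr_sqrt ?exprn_gt0//=.
have : `|a x| ^+ 2 < (e / 2) ^+ 2 by rewrite ltr_pXn2r ?nnegrE// ltW.
have : `|b x| ^+ 2 < (e / 2) ^+ 2 by rewrite ltr_pXn2r ?nnegrE// ltW.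
rewrite !real_normK ?num_real// => ? ?; nra.
Unshelve. all: by end_near. Qed.

(* No convergence is assumed: [lim] is chosen from the set of all limits, and this
   set is the same on both sides even when it is empty. *)
Lemma lim_inv_comparison (K : numFieldType) (V : normedModType K) (S H : R -> V) :
  S N - H N^-1 @[N --> +oo] --> (0 : V) ->
  lim (S N @[N --> +oo]) = lim (H d @[d --> 0^'+]).
Proof.
move=> SH; congr (get _); apply/funext => l; apply/propext; split => h.
- have HN : H N^-1 @[N --> +oo] --> l.
    have -> : (fun N => H N^-1) = (fun N => S N - (S N - H N^-1)).
      by apply/funext => N; rewrite opprB addrC subrK.
    by rewrite -[l]subr0; exact: cvgB.
  have -> : H = (fun d => H d^-1^-1) by apply/funext => d; rewrite invrK.
  exact: (cvg_comp _ _ cvg_inv_right0 HN).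
- have HN : H N^-1 @[N --> +oo] --> l by exact: (cvg_comp _ _ cvg_inv_pinfty h).
  have -> : S = (fun N => (S N - H N^-1) + H N^-1) by apply/funext => N; rewrite subrK.
  by rewrite -[l]add0r; exact: cvgD.
Qed.

(** Where no limit exists, [lim] returns [point] on both sides, and [point = 0] is its own
    opposite. *)
Lemma limN_any (K : numFieldType) (V : normedModType K) (T : Type)
    (F : set_system T) {FF : ProperFilter F} (u : T -> V) : point = 0 :> V ->
  lim (- u x @[x --> F]) = - lim (u x @[x --> F]).
Proof.
move=> p0; have [cu|du] := pselect (cvg (u x @[x --> F])); first exact: limN.
have dNu : ~ cvg (- u x @[x --> F]) by rewrite is_cvgNE.
by rewrite (dvgP du) (dvgP dNu) p0 oppr0.
Qed.

End complex_limits.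

(** * Re-expanded transforms and Hilbert transforms at Lebesgue points *)

Section pointwise.
Context {R : realType}.
Local Notation mu := (@lebesgue_measure R).
Local Notation Re := (@complex.Re R).
Local Notation Im := (@complex.Im R).
Implicit Types (f g : R -> R[i]) (x N : R).

Lemma Re_mull_real (r : R) (z : R[i]) : Re (r%:C * z) = r * Re z.
Proof. by case: z => a b /=; rewrite mul0r subr0. Qed.

Lemma Im_mull_real (r : R) (z : R[i]) : Im (r%:C * z) = r * Im z.
Proof. by case: z => a b /=; rewrite mul0r addr0. Qed.

Lemma cesaro_evenC g N x : 0 < N ->
  mu.-integrable `[0, +oo[ (EFin \o (Re \o g)) ->
  mu.-integrable `[0, +oo[ (EFin \o (Im \o g)) ->
  Cintegral `[0, N] (fun t => (1 - t / N)%:C * (inv_cosine g t * (sin (x * t))%:C)) =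
  (pi^-1 * \int[mu]_u (Re (even_ext g u) * conj_fejer N (x - u))) +i*
  (pi^-1 * \int[mu]_u (Im (even_ext g u) * conj_fejer N (x - u))).
Proof.
move=> N0 iRe iIm.
have := cesaro_even x N0 iRe; have := cesaro_even x N0 iIm => /= <- <-.
rewrite /Cintegral; congr (_ +i* _); apply: eq_Rintegral => t _.
  rewrite Re_mull_real Re_mulr_real /inv_cosine Re_mull_real.
  congr (_ * (_ * _ * _)) => /=.
  by apply: eq_Rintegral => u _; rewrite Re_mulr_real.
rewrite Im_mull_real Im_mulr_real /inv_cosine Im_mull_real; congr (_ * (_ * _ * _)) => /=.
by apply: eq_Rintegral => u _; rewrite Im_mulr_real.
Qed.

Lemma Re_odd_ext g u : Re (odd_ext g u) = Num.sg u * Re (g `|u|).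
Proof. exact: Re_mull_real. Qed.

Lemma Im_odd_ext g u : Im (odd_ext g u) = Num.sg u * Im (g `|u|).
Proof. exact: Im_mull_real. Qed.

Lemma integrable_Re_odd_ext g : mu.-integrable `[0, +oo[ (EFin \o (Re \o g)) ->
  mu.-integrable setT (EFin \o (Re \o odd_ext g)).
Proof.
by move=> iRe; apply: eq_integrable (integrable_odd iRe) => // u _; rewrite /= Re_odd_ext.
Qed.

Lemma integrable_Im_odd_ext g : mu.-integrable `[0, +oo[ (EFin \o (Im \o g)) ->
  mu.-integrable setT (EFin \o (Im \o odd_ext g)).
Proof.
by move=> iIm; apply: eq_integrable (integrable_odd iIm) => // u _; rewrite /= Im_odd_ext.
Qed.

Lemma cesaro_oddC g N x : 0 < N ->
  mu.-integrable `[0, +oo[ (EFin \o (Re \o g)) ->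
  mu.-integrable `[0, +oo[ (EFin \o (Im \o g)) ->
  Cintegral `[0, N] (fun t => (1 - t / N)%:C * (inv_sine g t * (cos (x * t))%:C)) =
  - ((pi^-1 * \int[mu]_u (Re (odd_ext g u) * conj_fejer N (x - u))) +i*
     (pi^-1 * \int[mu]_u (Im (odd_ext g u) * conj_fejer N (x - u)))).
Proof.
move=> N0 iRe iIm.
under [X in pi^-1 * X +i* _]eq_Rintegral do rewrite Re_odd_ext.
under [X in _ +i* (pi^-1 * X)]eq_Rintegral do rewrite Im_odd_ext.
have eRe := cesaro_odd x N0 iRe; have eIm := cesaro_odd x N0 iIm.
transitivity ((- (pi^-1 * \int[mu]_u (Num.sg u * Re (g `|u|) * conj_fejer N (x - u)))) +i*
  (- (pi^-1 * \int[mu]_u (Num.sg u * Im (g `|u|) * conj_fejer N (x - u))))) => //.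
rewrite -eRe -eIm /Cintegral; congr (_ +i* _); apply: eq_Rintegral => t _.
  rewrite Re_mull_real Re_mulr_real /inv_sine Re_mull_real; congr (_ * (_ * _ * _)) => /=.
  by apply: eq_Rintegral => u _; rewrite Re_mulr_real.
rewrite Im_mull_real Im_mulr_real /inv_sine Im_mull_real; congr (_ * (_ * _ * _)) => /=.
by apply: eq_Rintegral => u _; rewrite Im_mulr_real.
Qed.

Lemma Rintegral_cut_inv (G : R -> R) (d x : R) :
  \int[mu]_(t in [set t | d < `|t - x|]) (G t * (x - t)^-1) =
  \int[mu]_u (G u * cut_inv d (x - u)).
Proof.
rewrite Rintegral_mkcond; apply: eq_Rintegral => u _.
rewrite patchE /cut_inv distrC; case: ifPn => [/set_mem/= ->//|].
by rewrite notin_setE/= => /negP/negbTE ->; rewrite mulr0.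
Qed.

Lemma truncated_hilbertE (G : R -> R[i]) (d x : R) :
  (pi^-1)%:C * Cintegral [set t | d < `|t - x|] (fun t => G t / (x - t)%:C) =
  (pi^-1 * \int[mu]_u (Re (G u) * cut_inv d (x - u))) +i*
  (pi^-1 * \int[mu]_u (Im (G u) * cut_inv d (x - u))).
Proof.
have realM (r a b : R) : r%:C * (a +i* b) = (r * a) +i* (r * b).
  by apply/eqP; rewrite eq_complex /= !mul0r subr0 addr0 !eqxx.
rewrite -!Rintegral_cut_inv /Cintegral realM.
by congr ((_ * _) +i* (_ * _)); apply: eq_Rintegral => t _;
  rewrite -fmorphV ?Re_mulr_real ?Im_mulr_real.
Qed.

Lemma conv_diff_ker (G : R -> R) (N x : R) : 0 < N ->
  mu.-integrable setT (EFin \o G) ->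
  \int[mu]_u (G u * conj_fejer N (x - u)) - \int[mu]_u (G u * cut_inv N^-1 (x - u)) =
  \int[mu]_u (G u * diff_ker N (x - u)).
Proof.
move=> N0 Gi; rewrite -RintegralB//.
- by apply: eq_Rintegral => u _; rewrite -mulrBr.
- apply: (integrable_mul_bounded (M := N)) => //.
    by apply: (measurableT_comp (@measurable_conj_fejer R N)); exact: measurable_reflect.
  by move=> u _; exact: conj_fejer_le.
- apply: (integrable_mul_bounded (M := N^-1^-1)) => //.
    by apply: (measurableT_comp (@measurable_cut_inv R N^-1)); exact: measurable_reflect.
  by move=> u _; apply: cut_inv_le; rewrite invr_gt0.
Qed.

(** Common core of both parts, to be applied to the even and to the odd extension: the convolution
    with [K_N] and the Hilbert transform cut at [1 / N] differ by the convolution with [D_N]. *)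
Lemma cvg_conj_fejer_hilbert (G : R -> R[i]) (x : R) :
  mu.-integrable setT (EFin \o (Re \o G)) ->
  mu.-integrable setT (EFin \o (Im \o G)) ->
  lebesgue_pt (Re \o G) x -> lebesgue_pt (Im \o G) x ->
  ((pi^-1 * \int[mu]_u (Re (G u) * conj_fejer N (x - u))) +i*
   (pi^-1 * \int[mu]_u (Im (G u) * conj_fejer N (x - u))) -
   (pi^-1)%:C * Cintegral [set t | N^-1 < `|t - x|] (fun t => G t / (x - t)%:C) : R[i]^o)
    @[N --> +oo] --> (0 : R[i]^o).
Proof.
move=> iRe iIm pRe pIm.
have cvgpi (h : R -> R) : h N @[N --> +oo] --> (0 : R) ->
    pi^-1 * h N @[N --> +oo] --> (0 : R).
  by move=> h0; rewrite -(mulr0 pi^-1); exact: cvgM (cvg_cst _) h0.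
have h : ((pi^-1 * \int[mu]_u (Re (G u) * diff_ker N (x - u))) +i*
    (pi^-1 * \int[mu]_u (Im (G u) * diff_ker N (x - u))) : R[i]^o)
    @[N --> +oo] --> (0 : R[i]^o).
  by apply: cvg_complex0; apply: cvgpi;
    [exact: cvg_diff_ker iRe pRe|exact: cvg_diff_ker iIm pIm].
(* The kernel identities are available for [N > 0], hence only an eventual equality of the two
   functions of [N]. *)
refine (cvg_trans _ h); apply: near_eq_cvg; near=> N.
have N0 : 0 < N by near: N; apply: nbhs_pinfty_gt; exact: num_real.
rewrite truncated_hilbertE -(conv_diff_ker _ N0 iRe) -(conv_diff_ker _ N0 iIm).
by rewrite !mulrBr.
Unshelve. all: by end_near. Qed.

Lemma sine_transform_inv_cosine g x :
  mu.-integrable `[0, +oo[ (EFin \o (Re \o g)) ->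
  mu.-integrable `[0, +oo[ (EFin \o (Im \o g)) ->
  lebesgue_pt (Re \o even_ext g) x -> lebesgue_pt (Im \o even_ext g) x ->
  sine_transform (inv_cosine g) x = hilbert (even_ext g) x.
Proof.
move=> iRe iIm pRe pIm; apply: (@lim_inv_comparison R _ R[i]^o).
have h := cvg_conj_fejer_hilbert (integrable_even iRe) (integrable_even iIm) pRe pIm.
refine (cvg_trans _ h); apply: near_eq_cvg; near=> N.
have N0 : 0 < N by near: N; apply: nbhs_pinfty_gt; exact: num_real.
by rewrite (cesaro_evenC _ N0).
Unshelve. all: by end_near. Qed.

Lemma cosine_transform_inv_sine g x :
  mu.-integrable `[0, +oo[ (EFin \o (Re \o g)) ->
  mu.-integrable `[0, +oo[ (EFin \o (Im \o g)) ->
  lebesgue_pt (Re \o odd_ext g) x -> lebesgue_pt (Im \o odd_ext g) x ->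
  cosine_transform (inv_sine g) x = - hilbert (odd_ext g) x.
Proof.
move=> iRe iIm pRe pIm.
(* The sign is moved inside the limit first, so that the comparison applies to the opposite of the
   truncated transform. *)
transitivity (lim ((fun d : R => - ((pi^-1)%:C * Cintegral [set t | d < `|t - x|]
    (fun t => odd_ext g t / (x - t)%:C)) : R[i]^o) @ 0^'+) : R[i]^o); last first.
  exact: (@limN_any _ R[i]^o).
apply: (@lim_inv_comparison R _ R[i]^o).
have h := cvg_conj_fejer_hilbert (integrable_Re_odd_ext iRe) (integrable_Im_odd_ext iIm)
  pRe pIm; move: h => /cvgN; rewrite oppr0 => h.
refine (cvg_trans _ h); apply: near_eq_cvg; near=> N.
have N0 : 0 < N by near: N; apply: nbhs_pinfty_gt; exact: num_real.
by rewrite (cesaro_oddC _ N0)// opprK; exact: etrans (opprB _ _) (addrC _ _).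
Unshelve. all: by end_near. Qed.

End pointwise.

(** * Passage between representatives, and between the half-line and the line *)

Section transport.
Context {R : realType}.
Local Notation mu := (@lebesgue_measure R).
Local Notation Re := (@complex.Re R).
Local Notation Im := (@complex.Im R).
Implicit Types (f g : R -> R[i]) (x N : R) (D : set (measurableTypeR R)).

(** The exceptional set on the line is covered by the one on the half-line and its mirror image. *)
Lemma ae_eq_even_ext f g : ae_eq mu `[0, +oo[%classic f g ->
  ae_eq mu setT (even_ext f) (even_ext g).
Proof.
move=> fg; apply: (negligibleS _ (negligibleU fg (negligible_opp fg))) => x /= fgx.
have [x0|x0] := leP 0 x; [left|right] => /= h; apply: fgx => _; rewrite /even_ext.
  by rewrite ger0_norm//; apply: h; rewrite in_itv/= andbT.
by rewrite ltr0_norm//; apply: h; rewrite in_itv/= andbT oppr_ge0 ltW.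
Qed.

Lemma ae_eq_odd_ext f g : ae_eq mu `[0, +oo[%classic f g ->
  ae_eq mu setT (odd_ext f) (odd_ext g).
Proof.
move=> fg; apply: filterS (ae_eq_even_ext fg) => x /= h _.
by congr (_ * _); exact: h.
Qed.

Lemma ae_eq_Cintegral D f g : ae_eq mu D f g -> Cintegral D f = Cintegral D g.
Proof.
by move=> fg; congr (_ +i* _); apply: ae_eq_Rintegral; apply: filterS fg => x /= h /h ->.
Qed.

(** Integrals ignore null sets, so the equality holds at every point; this allows a function to be
    replaced by a Borel representative. *)
Lemma ae_eq_inv_cosine f g : ae_eq mu `[0, +oo[%classic f g ->
  inv_cosine f = inv_cosine g.
Proof.
move=> fg; apply/funext => t; congr (_ * _); apply: ae_eq_Cintegral.
by apply: filterS fg => x /= h /h ->.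
Qed.

Lemma ae_eq_inv_sine f g : ae_eq mu `[0, +oo[%classic f g ->
  inv_sine f = inv_sine g.
Proof.
move=> fg; apply/funext => t; congr (_ * _); apply: ae_eq_Cintegral.
by apply: filterS fg => x /= h /h ->.
Qed.

Lemma ae_eq_hilbert f g : ae_eq mu setT f g -> hilbert f = hilbert g.
Proof.
move=> fg; apply/funext => x; apply: (congr1 (fun h : R -> R[i]^o => lim (h @ 0^'+))).
apply/funext => d; congr (_ * _); apply: ae_eq_Cintegral.
by apply: filterS fg => t /= h _; rewrite (h I).
Qed.

Lemma L1_ae_eq D f g : ae_eq mu D f g -> L1 D g -> L1 D f.
Proof.
by move=> fg [h [mRe mIm hoo gh]]; exists h; split => //; exact: ae_eq_trans gh.
Qed.

Lemma L1_setTW D f : measurable D -> L1 setT f -> L1 D f.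
Proof.
move=> mD /(L1P _ measurableT)[g [iRe iIm fg]]; apply/L1P => //; exists g; split.
- exact: integrableS iRe.
- exact: integrableS iIm.
- exact: ae_eq_subset fg.
Qed.

Lemma L1N D f : measurable D -> L1 D f -> L1 D (fun x => - f x).
Proof.
move=> mD /(L1P _ mD)[g [iRe iIm fg]]; apply/L1P => //; exists (fun x => - g x); split.
- by apply: eq_integrable (integrableN iRe) => // x _ /=; case: (g x).
- by apply: eq_integrable (integrableN iIm) => // x _ /=; case: (g x).
- by apply: filterS fg => x /= h /h ->.
Qed.

Lemma L1_even_ext f : L1 `[0, +oo[ f -> L1 setT (even_ext f).
Proof.
move=> /(L1P _ (measurable_itv _))[g [iRe iIm fg]]; apply/L1P => //; exists (even_ext g).
by split; [exact: integrable_even iRe|exact: integrable_even iIm|exact: ae_eq_even_ext].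
Qed.

Lemma L1_odd_ext f : L1 `[0, +oo[ f -> L1 setT (odd_ext f).
Proof.
move=> /(L1P _ (measurable_itv _))[g [iRe iIm fg]]; apply/L1P => //; exists (odd_ext g).
by split;
  [exact: integrable_Re_odd_ext|exact: integrable_Im_odd_ext|exact: ae_eq_odd_ext].
Qed.

Lemma CintegralN D f : Cintegral D (fun t => - f t) = - Cintegral D f.
Proof.
rewrite /Cintegral; transitivity ((- \int[mu]_(t in D) Re (f t)) +i*
  (- \int[mu]_(t in D) Im (f t)) : R[i]) => //.
by rewrite -!RintegralN_any; congr (_ +i* _); apply: eq_Rintegral => t _; case: (f t).
Qed.

(** Holds at every [x], also where the Cesaro limit fails to exist, because [RintegralN_any] and
    [limN_any] respect the default values. *)
Lemma sine_transformN f x : sine_transform f (- x) = - sine_transform f x.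
Proof.
rewrite /sine_transform /cesaro_integral.
transitivity (lim ((fun N : R => - (Cintegral `[0, N]
   (fun t => (1 - t / N)%:C * (f t * (sin (x * t))%:C))) : R[i]^o) @ +oo) : R[i]^o);
  last first.
  exact: (@limN_any _ R[i]^o).
apply: (congr1 (fun h : R -> R[i]^o => lim (h @ +oo))).
apply/funext => N; rewrite -CintegralN.
by congr Cintegral; apply/funext => t; rewrite mulNr sinN rmorphN/= !mulrN.
Qed.

Lemma cosine_transformN f x : cosine_transform f (- x) = cosine_transform f x.
Proof. by rewrite /cosine_transform; under eq_fun do rewrite mulNr cosN. Qed.

Lemma sine_transform_odd_ext f : odd_ext (sine_transform f) = sine_transform f.
Proof.
apply/funext => x; rewrite /odd_ext; have [x0|x0|->] := ltgtP x 0.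
- by rewrite ltr0_sg// ltr0_norm// sine_transformN rmorphN1 mulN1r opprK.
- by rewrite gtr0_sg// gtr0_norm// mul1r.
(* Oddness makes the value at [0] its own opposite, hence [0]. *)
- rewrite sgr0 mul0r; have := sine_transformN f 0; rewrite oppr0 => /eqP.
  by rewrite -addr_eq0 -mulr2n mulrn_eq0/= => /eqP.
Qed.

Lemma cosine_transform_even_ext f : even_ext (cosine_transform f) = cosine_transform f.
Proof.
apply/funext => x; rewrite /even_ext; have [x0|x0] := leP 0 x.
  by rewrite ger0_norm.
by rewrite ltr0_norm// cosine_transformN.
Qed.

(** By Lebesgue differentiation almost every point is a Lebesgue point of both [G] and [H], which
    will be the real and imaginary parts of an extension. *)
Lemma ae_eq_lebesgue_pt (G H : R -> R) f g :
  mu.-integrable setT (EFin \o G) -> mu.-integrable setT (EFin \o H) ->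
  (forall x, lebesgue_pt G x -> lebesgue_pt H x -> f x = g x) ->
  ae_eq mu setT f g.
Proof.
move=> Gi Hi fg.
have lG := lebesgue_differentiation (open_integrable_locally openT Gi).
have lH := lebesgue_differentiation (open_integrable_locally openT Hi).
apply: (negligibleS _ (negligibleU lG lH)) => x /= fgx.
by apply: contrapT => /not_orP[/contrapT Gx /contrapT Hx]; apply: fgx => _; exact: fg.
Qed.

End transport.

(** * Equivalence of integrability for the two re-expansions *)

Theorem theorem1 (R : realType) :
  (forall Fc : R -> R[i],
     L1 `[0, +oo[ Fc ->
     (L1 `[0, +oo[ (sine_transform (inv_cosine Fc)) <->
     L1 setT (hilbert (even_ext Fc))))
  /\
  (forall Fs : R -> R[i],
     L1 `[0, +oo[ Fs ->
     (L1 `[0, +oo[ (cosine_transform (inv_sine Fs)) <->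
     L1 setT (hilbert (odd_ext Fs)))).
Proof.
split=> F /(L1P _ (measurable_itv _))[g [iRe iIm Fg]].
- rewrite (ae_eq_inv_cosine Fg) (ae_eq_hilbert (ae_eq_even_ext Fg)).
  have SH : ae_eq lebesgue_measure setT
      (sine_transform (inv_cosine g)) (hilbert (even_ext g)).
    apply: (ae_eq_lebesgue_pt (integrable_even iRe) (integrable_even iIm)) => x.
    exact: sine_transform_inv_cosine.
  (* The sine transform is its own odd extension, so integrability passes from the half-line to the
     line; the converse is restriction. *)
  split=> [/L1_odd_ext|H1]; first rewrite sine_transform_odd_ext.
    exact: L1_ae_eq (ae_eq_sym SH).
  by apply: L1_setTW => //; exact: L1_ae_eq H1.
- rewrite (ae_eq_inv_sine Fg) (ae_eq_hilbert (ae_eq_odd_ext Fg)).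
  have SH : ae_eq lebesgue_measure setT
      (cosine_transform (inv_sine g)) (fun x => - hilbert (odd_ext g) x).
    apply: (ae_eq_lebesgue_pt (integrable_Re_odd_ext iRe)
      (integrable_Im_odd_ext iIm)) => x.
    exact: cosine_transform_inv_sine.
  split=> [/L1_even_ext|H1]; first rewrite cosine_transform_even_ext.
    move=> /(L1N measurableT); apply: L1_ae_eq.
    by apply: filterS SH => x /= h _; rewrite (h I) opprK.
  by apply: L1_setTW => //; apply: L1_ae_eq SH _; exact: L1N.
Qed.
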